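(* The forcing $\mathbb{P}_{\mathcal{E}}$ does not add Cohen reals; that is, if $G$ is $\mathbb{P}_{\mathcal{E}}$-generic over $V$, then $V[G]$ contains no Cohen real over $V$.
   Context: $\mathcal{E}$ is the $\sigma$-ideal of subsets of $2^\omega$ generated by the closed null sets, i.e. the family of all sets that can be covered by countably many closed sets of measure zero with respect to the standard Haar (product) measure on $2^\omega$. $\mathbb{P}_{\mathcal{E}}$ is the forcing of Borel subsets of $2^\omega$ not in $\mathcal{E}$, ordered by inclusion. *)

(* Defs.v *)
(* Conventions.
   - The ground model V is the ambient type theory.
   - "V[G] |= phi for every P-generic G over V" is read as "every condition of P
     forces phi", where the forcing relation is defined in V, by recursion on
     P-names, in the usual way. *)
From HB Require Import structures.
From mathcomp Require Import all_boot all_order all_algebra.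
From mathcomp Require Import all_classical all_reals all_analysis.

Set Implicit Arguments.
Unset Strict Implicit.
Unset Printing Implicit Defensive.

Import Order.TTheory GRing.Theory Num.Theory.

Local Open Scope classical_set_scope.
Local Open Scope ring_scope.

(** * The sigma-ideal E on the Cantor space *)

Definition cylinder (s : seq bool) : set cantor_space :=
  [set x | forall i, (i < size s)%N -> x i = nth false s i].

(* The Haar (fair coin-tossing) measure as a Caratheodory outer measure: the
   infimum of the total mass of countable covers by cylinders, the cylinder of s
   having mass 2 ^ - size s.  On Borel sets this is the product measure. *)
Definition haar (R : realType) (A : set cantor_space) : \bar R :=
  ereal_inf [set (\sum_(0 <= k <oo) (2^-1 ^+ size (s k))%:E)%E
            | s in [set s : nat -> seq bool | A `<=` \bigcup_k cylinder (s k)]].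

Definition idealE (R : realType) : set (set cantor_space) :=
  [set A | exists C : nat -> set cantor_space,
     (forall n, closed (C n) /\ haar R (C n) = 0%E) /\ A `<=` \bigcup_n C n].

Definition borel : set (set cantor_space) := <<s open >>.

(** * Forcing notions, names and the forcing relation *)

(* [fle p q] : p is stronger than q.  No largest condition is required. *)
Record forcing := Forcing {
  cond :> Type;
  fle : cond -> cond -> Prop;
  fle_refl : forall p, fle p p;
  fle_trans : forall p q r, fle p q -> fle q r -> fle p r }.

Section PE.
Variable R : realType.

Definition PE_cond := {B : set cantor_space | borel B /\ ~ idealE R B}.
Definition PE_le (p q : PE_cond) : Prop := sval p `<=` sval q.
Lemma PE_le_refl p : PE_le p p. Proof. exact: subset_refl. Qed.
Lemma PE_le_trans p q r : PE_le p q -> PE_le q r -> PE_le p r.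
Proof. exact: subset_trans. Qed.
Definition PE : forcing := Forcing PE_le_refl PE_le_trans.

End PE.

(* The sets of the ground model (Aczel): [VSet f] is { f i | i : I }. *)
Inductive vset : Type := VSet (I : Type) (f : I -> vset).

(* P-names: [Name x c] is { (x i, c i) | i : I }. *)
Inductive name (P : forcing) : Type :=
  Name (I : Type) (x : I -> name P) (c : I -> P).

(* The canonical name of a ground model set.  In the absence of a largest
   condition, each element is paired with every condition. *)
Fixpoint check (P : forcing) (v : vset) : name P :=
  let: VSet T f := v in
  Name (fun ip : T * P => check P (f ip.1)) (fun ip => ip.2).

Section ForcingRelation.
Variable P : forcing.

(* A statement of the forcing language, identified with the predicate
   "p forces it". *)
Definition fprop := P -> Prop.

Fixpoint feq (s t : name P) (p : P) {struct s} : Prop :=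
  let: Name _ x c := s in let: Name _ y d := t in
  (forall i q, fle q p -> fle q (c i) ->
     exists r, fle r q /\ exists j, fle r (d j) /\ feq (x i) (y j) r) /\
  (forall j q, fle q p -> fle q (d j) ->
     exists r, fle r q /\ exists i, fle r (c i) /\ feq (x i) (y j) r).

Definition fmem (s t : name P) : fprop := fun p =>
  let: Name _ y d := t in
  forall q, fle q p ->
    exists r, fle r q /\ exists j, fle r (d j) /\ feq s (y j) r.

Definition fnot (A : fprop) : fprop := fun p => forall q, fle q p -> ~ A q.
Definition fand (A B : fprop) : fprop := fun p => A p /\ B p.
Definition fimp (A B : fprop) : fprop := fun p =>
  forall q, fle q p -> A q -> B q.

(* With T the type of P-names these are the quantifiers over V[G]; with T a type
   of ground model objects, the quantifiers over the corresponding set (or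
   class) of V, as in the forcing language with a predicate for V. *)
Definition fall (T : Type) (A : T -> fprop) : fprop := fun p => forall t, A t p.
Definition fex (T : Type) (A : T -> fprop) : fprop := fun p =>
  forall q, fle q p -> exists r, fle r q /\ exists t, A t r.

Definition fsub (s t : name P) : fprop :=
  fall (fun z : name P => fimp (fmem z s) (fmem z t)).

End ForcingRelation.

(** * Cohen reals *)

Definition vpair2 (a b : vset) : vset := VSet (fun c : bool => if c then a else b).
(* Kuratowski pairs and von Neumann natural numbers *)
Definition vpair (a b : vset) : vset := vpair2 (vpair2 a a) (vpair2 a b).
Definition vsucc (a : vset) : vset :=
  let: VSet T f := a in VSet (fun o : option T => if o is Some i then f i else a).
Fixpoint vnat (n : nat) : vset :=
  if n is m.+1 then vsucc (vnat m) else VSet (fun e : void => match e with end).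

Definition ventry (n : nat) (b : bool) : vset := vpair (vnat n) (vnat b).

Definition vomega2 : vset := VSet (fun nb : nat * bool => ventry nb.1 nb.2).

Definition vseq (s : seq bool) : vset :=
  VSet (fun i : 'I_(size s) => ventry i (nth false s i)).

Definition vseqs (D : set (seq bool)) : vset :=
  VSet (fun s : {s : seq bool | D s} => vseq (sval s)).

Definition dense_seqs (D : set (seq bool)) : Prop :=
  forall s, exists t, D t /\ prefix s t.

Section Cohen.
Variable P : forcing.

(* "x is a function from omega to 2" *)
Definition freal (x : name P) : fprop P :=
  fand (fsub x (check P vomega2))
 (fand (fall (fun n : nat => fex (fun b : bool => fmem (check P (ventry n b)) x)))
       (fall (fun n : nat => fnot (fand (fmem (check P (ventry n false)) x)
                                        (fmem (check P (ventry n true)) x))))).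

(* "x is a Cohen real over V": x : omega -> 2 has an initial segment in every
   dense subset of 2^{<omega} that belongs to V, i.e. the finite initial segments
   of x form a generic filter over V for Cohen forcing 2^{<omega}. *)
Definition fcohen (x : name P) : fprop P :=
  fand (freal x)
    (fall (fun D : {D : set (seq bool) | dense_seqs D} =>
       fex (fun z : name P =>
         fand (fmem z (check P (vseqs (sval D)))) (fsub z x)))).

Definition adds_no_cohen_real : Prop :=
  forall p : P, fnot (fex (fun x : name P => fcohen x)) p.

End Cohen.

(* Main.v *)
From HB Require Import structures.
Require Import Defs.
From mathcomp Require Import all_boot all_order all_algebra.
From mathcomp Require Import all_classical all_reals all_analysis.

Set Implicit Arguments.
Unset Strict Implicit.
Unset Printing Implicit Defensive.

Import Order.TTheory GRing.Theory Num.Theory.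

Local Open Scope classical_set_scope.

(** Why the forcing adds no Cohen real.  Let [x] be a name and [p0] a condition
forcing [x] to be a real.  By fusion one builds a condition [G] below [p0] and
words [W i], one extending each finite binary word, such that [G] forces [x] to
have no [W i] as an initial segment ([exists_fusion]).  The set of all [W i] is
dense, so [x] cannot be Cohen below [G].

The fusion runs through stages.  Stage [i] starts with finitely many nodes, each
carrying a condition, and with words [W j], [j < i], already chosen.  Each node
is heavy: for every [n], at least a fixed positive fraction of the words [s] of
length [n] are live, which means that some stronger condition inside the
cylinder of [s] forces [x] to disagree with every [W j], [j < i].  The next word
[W i] is sought among the [2 ^ l] words [O i ++ r] with [size r = l].  A live [s]
dies for at most one [r], because deciding one more bit of [x] excludes one of
two different words of equal length ([live_split]); so for large [l] some [r]
costs all the nodes only a tiny fraction ([exists_next_word]).  Then each live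
word of length [i] at each node gives birth to a child node, whose condition
lies in the cylinder and avoids the words chosen so far.

[G] is the set of points lying in the conditions of nodes born at arbitrarily
late stages.  It is Borel, and a condition below [G] meets the condition of a
node born after stage [i], hence can be strengthened to avoid [W i].  It is not
in the ideal: given closed null sets [C k], the fraction of the words of length
[n] whose cylinder meets [C k] tends to [0] by compactness
([haar_null_small]), whereas the fraction of live words at a node does not, so
there is a branch of nodes whose [k]-th step leaves [C k].

The conditions along such a branch decrease and their diameters shrink, but they
are only Borel, so their intersection could be empty.  Every Borel set therefore
comes with a scheme, a tree of Borel pieces each covered by its successors, such
that a point approximated along an infinite branch of pieces belongs to the set
([borel_scheme]).  A node remembers one piece for each of its ancestors, and
each birth refines all of these by one step, which is possible within the
forcing because the ideal is countably complete.  The limit point of the branch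
then lies in all the conditions ([extends_complete]), hence in [G]. *)

(** * Counting binary words *)

Fixpoint words (n : nat) : seq (seq bool) :=
  if n is m.+1 then flatten [seq [:: rcons s false; rcons s true] | s <- words m]
  else [:: [::]].

Lemma sum_wordsS n (f : seq bool -> nat) :
  \sum_(s <- words n.+1) f s
  = \sum_(s <- words n) (f (rcons s false) + f (rcons s true)).
Proof.
rewrite /= big_flatten big_map; apply: eq_bigr => s _.
by rewrite big_cons big_seq1.
Qed.

Lemma mem_words n s : (s \in words n) = (size s == n).
Proof.
elim: n s => [|n IH] s; first by rewrite inE size_eq0.
apply/flatten_mapP/idP => [[t]|].
  by rewrite IH !inE => /eqP <- /orP[] /eqP->; rewrite size_rcons.
case/lastP: s => // s b; rewrite size_rcons eqSS -IH => sn.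
by exists s => //; rewrite !inE; case: b; rewrite eqxx ?orbT.
Qed.

Lemma sum_words1 n : \sum_(s <- words n) 1 = 2 ^ n.
Proof.
elim: n => [|n IH]; first by rewrite big_seq1.
by rewrite sum_wordsS big_split /= IH expnS mul2n -addnn.
Qed.

Lemma size_words n : size (words n) = 2 ^ n.
Proof. by rewrite -sum1_size sum_words1. Qed.

Lemma words_uniq n : uniq (words n).
Proof.
elim: n => //= n IH.
have : forall l, uniq l ->
    uniq (flatten [seq [:: rcons s false; rcons s true] | s <- l]).
  elim=> //= s l IHl /andP[sl /IHl ul].
  rewrite ul andbT inE negb_or eqseq_rcons eqxx /=.
  by apply/andP; split; apply/flatten_mapP => -[t tl]; rewrite !inE !eqseq_rcons;
     case: (eqVneq s t) => //= E; move: sl; rewrite E tl.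
exact.
Qed.

Lemma sum_uniq_le1 (T : eqType) (r : seq T) (b : pred T) :
  uniq r -> (forall x y, x \in r -> y \in r -> b x -> b y -> x = y) ->
  \sum_(x <- r) (b x : nat) <= 1.
Proof.
elim: r => [|x r IH] /=; first by rewrite big_nil.
case/andP=> xr ur inj; rewrite big_cons; case bx: (b x); last first.
  by apply: IH => // y z yr zr; apply: inj; rewrite inE (yr, zr) orbT.
rewrite big_seq big1 // => y yr; case yb: (b y) => //.
by move: xr; rewrite (inj x y) ?yr// inE ?eqxx ?yr ?orbT.
Qed.

Lemma sum_words_prefix n s :
  \sum_(t <- words n) (prefix s t : nat) <= 2 ^ (n - size s).
Proof.
elim: n => [|n IH]; first by rewrite big_seq1 sub0n expn0; case: prefix.
case: (ltnP n (size s)) => ns.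
  apply: leq_trans (sum_uniq_le1 (words_uniq _) _) _; last by rewrite expn_gt0.
  move=> x y; rewrite !mem_words => /eqP xn /eqP yn.
  by rewrite !prefixE !take_oversize ?xn ?yn// => /eqP-> /eqP->.
rewrite subSn// expnS mul2n -addnn; apply: leq_trans (leq_add IH IH).
rewrite sum_wordsS -big_split leq_eqVlt; apply/orP; left; apply/eqP.
apply: eq_big_seq => t; rewrite mem_words => /eqP tn.
by rewrite !prefixE -!cats1 !takel_cat// tn.
Qed.

(** The averaging argument behind the choice of the next word to avoid: if an
element of [P] is lost by at most one [Q r], then the losses over all [r] of
length [l] add up to no more than [P] itself, although there are [2 ^ l] of
them. *)
Lemma sum_words_loss n l (P : pred (seq bool)) (Q : seq bool -> pred (seq bool)) :
  (forall s r r', size r = l -> size r' = l -> r != r' -> P s -> Q r s || Q r' s) ->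
  \sum_(r <- words l) \sum_(s <- words n) (P s && ~~ Q r s : nat)
  <= \sum_(s <- words n) (P s : nat).
Proof.
move=> PQ; rewrite exchange_big; apply: leq_sum => s _.
case Ps: (P s) => /=; last by rewrite big1.
apply: sum_uniq_le1 => [|r r']; first exact: words_uniq.
rewrite !mem_words => /eqP rl /eqP r'l nr nr'; apply/eqP; apply: contraT => rr'.
by move: (PQ s r r' rl r'l rr' Ps); rewrite (negbTE nr) (negbTE nr').
Qed.

(** The density of a tree among the words of length [n] decreases with [n], so a
lower bound at one length holds at all smaller lengths. *)
Lemma sum_words_shrink n (P : pred (seq bool)) :
  (forall s b, P (rcons s b) -> P s) ->
  \sum_(s <- words n.+1) (P s : nat) <= 2 * \sum_(s <- words n) (P s : nat).
Proof.
move=> PS; rewrite sum_wordsS big_distrr; apply: leq_sum => s _ /=.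
case Ps: (P s); first by rewrite muln1; do 2 case: (P (rcons _ _)).
by do 2 (case: (boolP (P (rcons _ _))) => [/PS|_]; rewrite ?Ps //).
Qed.

Lemma exists_le_average (T : eqType) (r : seq T) (f : T -> nat) A :
  (0 < size r)%N -> (\sum_(x <- r) f x <= A)%N ->
  exists2 x, x \in r & (size r * f x <= A)%N.
Proof.
move=> r0 fA; apply: contrapT => nex.
have : (\sum_(x <- r) A.+1 <= \sum_(x <- r) size r * f x)%N.
  rewrite !big_seq; apply: leq_sum => x xr.
  by rewrite ltnNge; apply/negP => le; apply: nex; exists x.
rewrite -big_distrr big_const_seq count_predT iter_addn_0 mulnC leq_mul2l.
by rewrite eqn0Ngt r0 /= leqNgt ltnS fA.
Qed.

(** * Cylinders in the Cantor space *)

Lemma cylinderP s (x : cantor_space) :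
  cylinder s x <-> s = mkseq x (size s).
Proof.
split=> [sx|sx i si]; last by rewrite sx nth_mkseq.
by apply: (@eq_from_nth _ false); rewrite ?size_mkseq// => i si; rewrite nth_mkseq// sx.
Qed.

Lemma cylinder_mkseq (x : cantor_space) n : cylinder (mkseq x n) x.
Proof. by apply/cylinderP; rewrite size_mkseq. Qed.

Lemma cylinder_prefix s t : prefix s t -> cylinder t `<=` cylinder s.
Proof.
case/prefixP=> u -> x tx i si.
by rewrite tx ?size_cat ?ltn_addr// nth_cat si.
Qed.

Lemma prefix_cylinder s t x :
  cylinder s x -> cylinder t x -> size s <= size t -> prefix s t.
Proof.
move=> /cylinderP sx /cylinderP tx st; rewrite prefixE tx sx size_mkseq.
rewrite -(subnK st) addnC /mkseq iotaD map_cat take_cat size_map size_iota ltnn.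
by rewrite subnn take0 cats0.
Qed.

Lemma coord_continuous (i : nat) : continuous (fun x : cantor_space => x i).
Proof. exact: (@proj_continuous nat (fun=> bool) i). Qed.

Lemma cylinder_clopen s : open (cylinder s) /\ closed (cylinder s).
Proof.
have cE b i A : [set x : cantor_space | (x i == b) = A] = 
  (fun x : cantor_space => x i) @^-1` [set c | (c == b) = A] by [].
have clop b i A : clopen [set x : cantor_space | (x i == b) = A].
  rewrite cE; apply: preimage_clopen; last exact: coord_continuous.
  by split; [exact: discrete_open|exact: discrete_closed].
have -> : cylinder s = \bigcap_(i in `I_(size s)) [set x | (x i == nth false s i) = true].
  by apply/seteqP; split=> x sx i /sx /= /eqP.
split; last by apply: closed_bigI => i _; exact: (clop _ _ _).2.
rewrite -closedC setC_bigcap; apply: closed_bigcup => [|i _]; first exact: finite_II.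
by rewrite closedC; exact: (clop _ _ _).1.
Qed.

Lemma open_cylinder (U : set cantor_space) x :
  open U -> U x -> exists n, cylinder (mkseq x n) `<=` U.
Proof.
move=> oU Ux; pose F := filter_from [set: nat] (fun n => cylinder (mkseq x n)).
have FF : Filter F.
  apply: filter_from_filter; first by exists 0%N.
  move=> i j _ _; exists (maxn i j) => // y; rewrite /cylinder /= !size_mkseq => H.
  have K k : (k < maxn i j)%N -> y k = x k by move=> kk; rewrite H// nth_mkseq.
  by split=> k ki; rewrite nth_mkseq// K// leq_max ki ?orbT.
have Fx : {ptws, F --> (x : nat -> bool)}.
  apply/pointwise_cvgP => t A /nbhs_singleton At.
  exists t.+1 => // y yx.
  by rewrite /= (yx t) ?size_mkseq// nth_mkseq.
have [n _ nU] : F U by apply: Fx; exact: open_nbhs_nbhs.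
by exists n.
Qed.

Definition agree n (x y : cantor_space) := forall i, (i < n)%N -> x i = y i.

Lemma closed_agree (F : set cantor_space) x :
  closed F -> (forall n, exists2 y, F y & agree n x y) -> F x.
Proof.
rewrite -openC => oF Fx; apply: contrapT => nFx.
have [n nF] := open_cylinder oF nFx; have [y Fy xy] := Fx n.
by apply: (nF y) => // i; rewrite size_mkseq => ni; rewrite nth_mkseq// -xy.
Qed.

(** * Null sets and densities of words *)

Lemma haar_ge0 (R : realType) A : (0 <= haar R A)%E.
Proof.
apply: le_ereal_inf_tmp => _ [s _ <-]; apply: nneseries_ge0 => k _ _.
by rewrite lee_fin exprn_ge0// invr_ge0.
Qed.

(** By compactness a cover of small mass has a finite subcover, and at a length
[n] beyond those of its words, the words meeting [F] extend one of them. *)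
Lemma haar_null_small (R : realType) F k N :
  closed F -> haar R F = 0%E ->
  exists2 n, (N <= n)%N &
    (2 ^ k * \sum_(s <- words n) (`[< F `&` cylinder s !=set0 >] : nat) < 2 ^ n)%N.
Proof.
move=> cF F0.
have e0 : (0 < 2^-1 ^+ k :> R)%R by rewrite exprn_gt0// invr_gt0.
have : (haar R F < (2^-1 ^+ k)%:E)%E by rewrite F0 lte_fin.
case/ereal_inf_lt => _ [s /= Fs <-] sk.
have : @cover_compact cantor_space F.
  by rewrite -compact_cover; apply: (subclosed_compact cF cantor_space_compact).
move=> /(_ nat setT (fun j => cylinder (s j)) (fun j _ => (cylinder_clopen _).1)).
case=> [x /Fs [j _ sx]|D _ FD]; first by exists j.
pose m := (\max_(j <- finmap.enum_fset D) j).+1.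
have {}FD x : F x -> exists2 j, (j < m)%N & cylinder (s j) x.
  case/FD => j /= jD sx; exists j => //; rewrite ltnS.
  exact: (@leq_bigmax_seq _ _ xpredT id).
pose n := maxn N (\max_(j < m) size (s j)).
have sn (j : 'I_m) : (size (s j) <= n)%N.
  rewrite leq_max; apply/orP; right.
  exact: (@leq_bigmax 'I_m (fun j => size (s j))).

exists n; first by rewrite leq_maxl.
have cnt : (\sum_(t <- words n) (`[< F `&` cylinder t !=set0 >] : nat) <=
            \sum_(j < m) 2 ^ (n - size (s j)))%N.
  apply: (@leq_trans (\sum_(j < m) \sum_(t <- words n) (prefix (s j) t : nat))); last first.
    by apply: leq_sum => j _; exact: sum_words_prefix.
  rewrite exchange_big big_seq [leqRHS]big_seq; apply: leq_sum => t.
  rewrite mem_words => /eqP tn; case: asboolP => // -[x [/FD[j jm sx] tx]].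
  rewrite (bigD1 (Ordinal jm)) //= (prefix_cylinder sx tx) ?add1n//.
  by rewrite tn (sn (Ordinal jm)).
have : (\sum_(j < m) (2^-1 ^+ size (s j)) < 2^-1 ^+ k :> R)%R.
  rewrite -lte_fin; apply: le_lt_trans sk; rewrite -sumEFin.
  rewrite -(big_mkord xpredT (fun j => (2^-1 ^+ size (s j))%:E)).
  by apply: nneseries_lim_ge => j _ _; rewrite lee_fin exprn_ge0// invr_ge0.
rewrite -(ltr_pM2r (_ : 0 < 2 ^+ n)%R); last by rewrite exprn_gt0.
rewrite mulr_suml => H.
rewrite -(ltr_nat R) natrM !natrX mulrC -ltr_pdivlMr ?exprn_gt0//.
rewrite -exprVn [ltRHS]mulrC; apply: le_lt_trans H.
apply: (@le_trans _ _ (\sum_(j < m) 2 ^ (n - size (s j)))%:R%R).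
  by rewrite ler_nat.
rewrite natr_sum; apply: ler_sum => j _.
by rewrite natrX -[in leRHS](subnKC (sn j)) exprD mulrA -exprMn mulVf
  ?pnatr_eq0// expr1n mul1r.
Qed.

(** Covers in the definition of [haar] are infinite sequences of cylinders, so
the finite cover at length [n] is continued by cylinders of total mass at most
[2 ^ - k]. *)
Lemma small_haar_null (R : realType) (F : set cantor_space) :
  (forall k, exists n (P : pred (seq bool)), [/\ forall x, F x -> P (mkseq x n) &
     (2 ^ k * \sum_(s <- words n) (P s : nat) <= 2 ^ n)%N]) ->
  haar R F = 0%E.
Proof.
move=> small; apply/eqP; rewrite eq_le haar_ge0 andbT.
suff le k : (haar R F <= (2^-1 ^+ k + 2^-1 ^+ k)%:E)%E.
  apply/lee_addgt0Pr => e e0; rewrite add0e.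
  have [k ke] : exists k, (2^-1 ^+ k + 2^-1 ^+ k <= e :> R)%R.
    have [k ke] : exists k, (2^-1 ^+ k < e :> R)%R.
      have := @cvg_geometric R 1%R 2^-1%R; rewrite ger0_norm ?invr_ge0// invf_lt1// ltr1n.
      move=> /(_ erefl) /cvgrPdist_lt /(_ e e0) [k _ /(_ k (leqnn _))].
      rewrite /= sub0r normrN mul1r ger0_norm ?exprn_ge0 ?invr_ge0// => ke.
      by exists k.
    exists k.+1; rewrite exprS -mulrDl -mulr2n -[(2^-1 *+ 2)%R]mulr_natl mulfV ?pnatr_eq0//.
    by rewrite mul1r ltW.
  by apply: le_trans (le k) _; rewrite lee_fin.
have [n [P [FP Pn]]] := small k.
pose L := [seq s <- words n | P s]; pose m := size L.
have mE : m = \sum_(s <- words n) (P s : nat) by rewrite /m size_filter -sum1_count big_mkcond.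
pose s j := if (j < m)%N then nth [::] L j else nseq (j.+1 + k) false.
apply: (@le_trans _ _ (\sum_(0 <= j <oo) (2^-1 ^+ size (s j))%:E)%E).
  apply: ereal_inf_lbound; exists s => // x Fx.
  have xL : mkseq x n \in L by rewrite mem_filter FP//= mem_words size_mkseq.
  exists (index (mkseq x n) L) => //.
  by rewrite /s index_mem xL nth_index//; exact: cylinder_mkseq.
pose A j : \bar R := (if (j < m)%N then 2^-1 ^+ n else 0)%:E.
have A0 j : (0 <= A j)%E by rewrite /A; case: ifP => // _; rewrite lee_fin exprn_ge0 ?invr_ge0.
have e0 : (0 <= 2^-1 ^+ k :> R)%R by rewrite exprn_ge0// invr_ge0.
apply: (@le_trans _ _ (\sum_(0 <= j <oo) (A j + (2^-1 ^+ k / (2 ^ j.+1)%:R)%:E))%E).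
  apply: lee_nneseries => [j _ _|j _]; first by rewrite lee_fin exprn_ge0// invr_ge0.
  rewrite /A /s -EFinD lee_fin; case: ifP => jm.
    have := mem_nth [::] jm; rewrite mem_filter mem_words => /andP[_ /eqP->].
    by rewrite lerDl divr_ge0.
  by rewrite size_nseq add0r exprD mulrC natrX !exprVn.
apply: le_trans (epsilon_trick xpredT A0 e0) _.
rewrite EFinD leeD2r// (nneseries_split 0 m)//= add0n eseries0 ?adde0; last first.
  by move=> j mj _; rewrite /A ltnNge mj.
rewrite (eq_big_nat _ _ (F2 := fun=> (2^-1 ^+ n)%:E)); last
  by move=> j /andP[_ jm]; rewrite /A jm.
rewrite sumEFin lee_fin sumr_const_nat subn0 -[(_ *+ m)%R]mulr_natl !exprVn.
rewrite ler_pdivrMr ?exprn_gt0// mulrC ler_pdivlMr ?exprn_gt0//.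
by rewrite -!natrX -natrM ler_nat mulnC mE.
Qed.

(** * The ideal and its positive sets *)

Section IdealE.
Variable R : realType.
Local Notation idealE := (idealE R).

Lemma idealE_sub A B : A `<=` B -> idealE B -> idealE A.
Proof. by move=> AB [C [HC BC]]; exists C; split=> //; exact: subset_trans BC. Qed.

Lemma haar_set0 : haar R set0 = 0%E.
Proof.
apply: small_haar_null => k; exists 0, xpred0; split=> //.
by rewrite big1 ?muln0.
Qed.

Lemma idealE_closed_null F : closed F -> haar R F = 0%E -> idealE F.
Proof. by move=> cF F0; exists (fun=> F); split=> // x Fx; exists 0. Qed.

Lemma idealE_set0 : idealE set0.
Proof. exact: idealE_closed_null closed0 haar_set0. Qed.

Lemma idealE_bigcup (T : countType) (F : T -> set cantor_space) :
  (forall t, idealE (F t)) -> idealE (\bigcup_t F t).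
Proof.
move=> /choice[C HC].
pose D k := if unpickle k is Some (t, m) then C t m else set0.
exists D; split=> [k|x [t _ /(HC t).2 [m _ xm]]]; last first.
  by exists (pickle (t, m)) => //; rewrite /D pickleK.
rewrite /D; case: unpickle => [[t m]|]; first exact: (HC t).1.
by split; [exact: closed0|exact: haar_set0].
Qed.

Lemma idealE_setU A B : idealE A -> idealE B -> idealE (A `|` B).
Proof.
move=> EA EB; apply: idealE_sub (_ : idealE (\bigcup_b (if b then A else B))).
  by move=> x [Ax|Bx]; [exists true|exists false].
by apply: idealE_bigcup => -[].
Qed.

Lemma positive_piece (T : countType) (F : T -> set cantor_space) A :
  ~ idealE A -> A `<=` \bigcup_t F t -> exists t, ~ idealE (A `&` F t).
Proof.
move=> nA AF; apply/existsNP => EF; apply: nA.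
apply: idealE_sub (idealE_bigcup EF) => x Ax.
by have [t _ Fx] := AF _ Ax; exists t.
Qed.

(** The words [s] with [A] positive in the cylinder of [s] form a tree whose
branches make up a closed set [K], and [A] outside [K] is in the ideal.  If the
density of this tree tended to [0], then [K] would be null. *)
Lemma positive_levels A : ~ idealE A -> exists k, forall n,
  (2 ^ n.+1 <= 2 ^ k * \sum_(s <- words n) (`[< ~ idealE (A `&` cylinder s) >] : nat))%N.
Proof.
move=> nA; apply: contrapT => /forallNP small; apply: nA.
pose T s := `[< ~ idealE (A `&` cylinder s) >].
pose K := \bigcap_(s in [set s | ~~ T s]) ~` cylinder s.
have cK : closed K.
  apply: closed_bigI => s _; rewrite closedC; exact: (cylinder_clopen _).1.
have K0 : haar R K = 0%E.
  apply: small_haar_null => k; have /existsNP[n /negP] := small k.+1.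
  rewrite -ltnNge expnS -mulnA expnS ltn_mul2l /= => /ltnW le.
  exists n, T; split=> // x Kx; apply: contraT => nT.
  by case: (Kx _ nT); exact: cylinder_mkseq.
apply: (@idealE_sub _ (K `|` \bigcup_s (if T s then set0 else A `&` cylinder s))).
  move=> x Ax; have [Kx|nK] := pselect (K x); [by left|right].
  move/existsNP: nK => [s /not_implyP[nT /contrapT sx]].
  by exists s => //; rewrite (negbTE nT).
apply: idealE_setU; first exact: idealE_closed_null.
apply: idealE_bigcup => s; case: (boolP (T s)) => [_|/asboolPn/contrapT//].
exact: idealE_set0.
Qed.

End IdealE.

(** * Borel sets and their schemes *)

Lemma borel_setC A : borel A -> borel (~` A).
Proof. exact: (@measurableC _ (g_sigma_algebraType (@open cantor_space))). Qed.

Lemma borel_setI A B : borel A -> borel B -> borel (A `&` B).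
Proof. exact: (@measurableI _ (g_sigma_algebraType (@open cantor_space))). Qed.

Lemma borel_bigcup (F : nat -> set cantor_space) :
  (forall n, borel (F n)) -> borel (\bigcup_n F n).
Proof.
move=> BF; apply: (@bigcup_measurable _ (g_sigma_algebraType (@open cantor_space))).
by move=> k _; exact: BF.
Qed.

Lemma borel_bigcap (F : nat -> set cantor_space) :
  (forall n, borel (F n)) -> borel (\bigcap_n F n).
Proof.
move=> BF; rewrite -[X in borel X]setCK setC_bigcap.
by apply: borel_setC; apply: borel_bigcup => n; exact: borel_setC.
Qed.

Lemma borel_open U : open U -> borel U.
Proof. exact: sub_gen_smallest. Qed.

Lemma borel_closed F : closed F -> borel F.
Proof. by rewrite -openC => /borel_open/borel_setC; rewrite setCK. Qed.

(** A Suslin scheme for [B] whose pieces are Borel, so that they can be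
intersected with conditions of the forcing, and which is complete: the pieces
along a branch only need to come arbitrarily close to [x] for [x] to be in
[B]. *)
Definition scheme (P : seq nat -> set cantor_space) (B : set cantor_space) :=
  [/\ B `<=` P [::],
      forall u, borel (P u),
      forall u, P u `<=` \bigcup_m P (rcons u m) &
      forall x y, (forall n, exists2 x', P (mkseq y n) x' & agree n x x') -> B x].

Lemma scheme_closed F : closed F -> scheme (fun=> F) F.
Proof.
move=> cF; split=> // [_|u x Fx|x _]; [exact: borel_closed|by exists 0|].
exact: closed_agree.
Qed.

Lemma scheme_bigcup (B : nat -> set cantor_space) :
  (forall i, exists P, scheme P (B i)) -> exists P, scheme P (\bigcup_i B i).
Proof.
move=> /choice[P HP].
exists (fun u => if u is i :: v then P i v else \bigcup_i P i [::]); split.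
- by move=> x [i _ Bx]; exists i => //; have [+ _ _ _] := HP i; exact.
- case=> [|i v]; last by have [_ + _ _] := HP i; exact.
  by apply: borel_bigcup => i; have [_ + _ _] := HP i; exact.
- case=> [|i v] x /=; first by case=> i _ Px; exists i.
  by have [_ _ + _] := HP i; exact.
- move=> x y H; exists (y 0%N) => //; have [_ _ _] := HP (y 0%N).
  move/(_ x (y \o succn)); apply=> n; have [x'] := H n.+1.
  rewrite /mkseq /= -(addn0 1) iotaDl -map_comp => Px' xx'.
  by exists x' => // i ni; apply: xx'; exact: ltnW.
Qed.

Lemma mkseqS_rcons (T : Type) (y : nat -> T) n : mkseq y n.+1 = rcons (mkseq y n) (y n).
Proof. by rewrite /mkseq -addn1 iotaD map_cat cats1. Qed.

(** A branch for the intersection codes one branch for each [B i]: the [m]-th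
entry codes a finite sequence giving the next steps of the branches [i <= m].
The branch for [B i] starts moving at time [i], so that each entry only has to
carry finitely many steps. *)
Lemma scheme_bigcap (B : nat -> set cantor_space) :
  (forall i, exists P, scheme P (B i)) -> exists P, scheme P (\bigcap_i B i).
Proof.
move=> /choice[P HP].
pose dec m i := nth 0%N (odflt [::] (unpickle m)) i.
pose row i (u : seq nat) := [seq dec m i | m <- drop i u].
exists (fun u => \bigcap_i P i (row i u)); split.
- by move=> x Bx i _; have [+ _ _ _] := HP i; apply; exact: Bx.
- by move=> u; apply: borel_bigcap => i; have [_ + _ _] := HP i; exact.
- move=> u x Px.
  have /choice[f Hf] : forall i, exists m, P i (rcons (row i u) m) x.
    by move=> i; have [_ _ + _] := HP i => /(_ _ _ (Px i I)) [m _ Pm]; exists m.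
  exists (pickle (mkseq f (size u).+1)) => // i _.
  rewrite /row; case: (leqP i (size u)) => iu.
    by rewrite drop_rcons// map_rcons /dec pickleK /= nth_mkseq//; exact: Hf.
  rewrite drop_oversize ?size_rcons//; have := Px i I.
  by rewrite /row drop_oversize//; exact: ltnW.
- move=> x y H i _; have [_ _ _] := HP i.
  move/(_ x (fun n => dec (y (i + n)) i)); apply=> n; have [x' Px' xx'] := H (i + n).
  exists x'; last by move=> j jn; rewrite xx'// ltn_addl.
  have := Px' i I; rewrite /row /mkseq iotaD add0n map_cat drop_size_cat
    ?size_map ?size_iota//.
  by rewrite -[X in iota X]addn0 iotaDl -!map_comp.
Qed.

(** The sets with a scheme are not visibly closed under complement, so the
induction on Borel sets is for sets which have a scheme together with their
complement. *)
Lemma borel_scheme B : borel B -> exists P, scheme P B.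
Proof.
move=> bB.
suff : [set B | (exists P, scheme P B) /\ exists P, scheme P (~` B)] B by case.
apply: smallest_sub bB; first split.
- by split; [exists (fun=> set0); apply: scheme_closed; exact: closed0|
     rewrite setC0; exists (fun=> setT); apply: scheme_closed; exact: closedT].
- by move=> A [PA PCA]; rewrite setTD; split=> //; rewrite setCK.
- move=> F HF; split; first by apply: scheme_bigcup => i; exact: (HF i).1.
  by rewrite setC_bigcup; apply: scheme_bigcap => i; exact: (HF i).2.
move=> U oU; split; last by exists (fun=> ~` U); apply: scheme_closed; rewrite closedC.
pose F i : set cantor_space := if unpickle i is Some s then
  (if `[< cylinder s `<=` U >] then cylinder s else set0) else set0.
have -> : U = \bigcup_i F i.
  apply/seteqP; split=> x.
    move=> Ux; have [n nU] := open_cylinder oU Ux.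
    exists (pickle (mkseq x n)) => //; rewrite /F pickleK; case: asboolP => // _.
    exact: cylinder_mkseq.
  by case=> i _; rewrite /F; case: unpickle => // s; case: asboolP => // sU /sU.
apply: scheme_bigcup => i; exists (fun=> F i); apply: scheme_closed.
rewrite /F; case: unpickle => [s|]; last exact: closed0.
by case: asboolP => _; [exact: (cylinder_clopen _).2|exact: closed0].
Qed.

(** * Histories *)

(** A list of schemes, each with a position in its tree. *)
Definition hist : Type := seq ((seq nat -> set cantor_space) * seq nat).
Definition track (h : hist) i := nth (fun=> setT, [::]) h i.
Definition region (h : hist) : set cantor_space :=
  \bigcap_i (track h i).1 (track h i).2.

Definition wf_hist (h : hist) := forall i u, borel ((track h i).1 u) /\
  (track h i).1 u `<=` \bigcup_m (track h i).1 (rcons u m).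

Definition extends (h : hist) (B : set cantor_space) (h' : hist) : Prop :=
  [/\ size h' = (size h).+1,
      forall i, (i < size h)%N -> exists m,
        track h' i = ((track h i).1, rcons (track h i).2 m) &
      scheme (track h' (size h)).1 B /\ (track h' (size h)).2 = [::]].

(** The scheme added at time [n] for [B n] is advanced forever after, so a point
approximated by the regions of the whole run is approximated along a branch of
that scheme. *)
Lemma extends_complete (h : nat -> hist) (B : nat -> set cantor_space) x :
  h 0%N = [::] -> (forall n, extends (h n) (B n) (h n.+1)) ->
  (forall n, exists2 x', region (h n) x' & agree n x x') ->
  forall n, B n x.
Proof.
move=> h0 hS hx n.
have sz m : size (h m) = m by elim: m => [|m IH]; [rewrite h0|case: (hS m) => ->; rewrite IH].
have [_ _] := hS n; rewrite sz; set c := track _ n => -[[_ _ _ complete] c0].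
pose y j := last 0%N (track (h (n.+1 + j.+1)) n).2.
have run j : track (h (n.+1 + j)) n = (c.1, mkseq y j).
  elim: j => [|j IH]; first by rewrite addn0 -/c [c]surjective_pairing c0.
  have [_ + _] := hS (n.+1 + j); rewrite sz => /(_ n (leq_addr _ _)) [m].
  by rewrite -addnS IH /= mkseqS_rcons /y => ->; rewrite last_rcons.
apply: (complete x y) => j; have [x' hx' xx'] := hx (n.+1 + j).
exists x'; first by have := hx' n I; rewrite run.
by move=> i ij; apply: xx'; exact: ltn_addl.
Qed.

(** * Nodes and the words that they still allow *)

(** [nfrac t] is the exponent [k] of a lower bound [2 ^ - k] for the density of
the live words at [t]. *)
Record node (R : realType) := Node { ncond : PE R; nhist : hist; nfrac : nat }.
HB.instance Definition _ (R : realType) := gen_eqMixin (node R).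

Section Fusion.
Variable R : realType.
Implicit Types p q : PE R.

Definition pe_cond (B : set cantor_space) (bB : borel B) (pB : ~ idealE R B) : PE R :=
  exist _ B (conj bB pB).

Lemma pe_borel q : borel (sval q). Proof. exact: (proj2_sig q).1. Qed.
Lemma pe_pos q : ~ idealE R (sval q). Proof. exact: (proj2_sig q).2. Qed.
Arguments pe_pos : clear implicits.

(** There are only countably many ways to advance all schemes by one step, and
together they cover [q]; so one of them keeps a positive part of [q]. *)
Lemma exists_extension h q : wf_hist h -> sval q `<=` region h ->
  exists q' h', [/\ fle q' q, wf_hist h', extends h (sval q) h' & sval q' `<=` region h'].
Proof.
move=> wh qh; have [P HP] := borel_scheme (pe_borel q).
have [qP bP coverP _] := HP.
pose H (ms : seq nat) : hist := mkseq (fun i => if (i < size h)%N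
  then ((track h i).1, rcons (track h i).2 (nth 0%N ms i)) else (P, [::])) (size h).+1.
have HE ms i : (i < (size h).+1)%N -> track (H ms) i = if (i < size h)%N
  then ((track h i).1, rcons (track h i).2 (nth 0%N ms i)) else (P, [::]).
  by move=> ih; rewrite /track nth_mkseq.
have H0 ms i : ((size h).+1 <= i)%N -> track (H ms) i = (fun=> setT, [::]).
  by move=> ih; rewrite /track nth_default// size_mkseq.
have wH ms : wf_hist (H ms).
  move=> i u; case: (ltnP i (size h).+1) => ih; last first.
    by rewrite H0//; split; [apply: borel_closed; exact: closedT|exists 0%N].
  by rewrite HE//; case: ifP => _; [exact: wh|split; [exact: bP|exact: coverP]].
have eH ms : extends h (sval q) (H ms).
  split; first by rewrite size_mkseq.
    by move=> i ih; rewrite HE ?ih; [exists (nth 0%N ms i)|exact: ltnW].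
  by rewrite HE// ltnn.
have [ms Hms] : exists ms, ~ idealE R (sval q `&` region (H ms)).
  apply: (positive_piece (pe_pos q)) => x qx.
  have /choice[f Hf] : forall i, exists m, (track h i).1 (rcons (track h i).2 m) x.
    by move=> i; have [_ /(_ _ (qh x qx i I))[m _ ?]] := wh i (track h i).2; exists m.
  exists (mkseq f (size h)) => // i _.
  case: (ltnP i (size h).+1) => ih; last by rewrite H0.
  by rewrite HE//; case: ifP => [ih'|_]; [rewrite nth_mkseq//; exact: Hf|exact: qP].
have bq : borel (sval q `&` region (H ms)).
  by apply: borel_setI (pe_borel q) _; apply: borel_bigcap => i; exact: (wH ms i _).1.
exists (pe_cond bq Hms), (H ms); split=> //; first exact: subIsetl.
exact: subIsetr.
Qed.

Variable p0 : PE R.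
(* [dec q n b] stands for: [q] forces the [n]-th bit of the name to be [b]. *)
Variable dec : PE R -> nat -> bool -> Prop.
Hypothesis dec_mono : forall q (r : PE R) n b, fle r q -> dec q n b -> dec r n b.
Hypothesis dec_total : forall q n, fle q p0 -> exists r b, fle r q /\ dec r n b.

Definition avoid q (W : seq bool) :=
  exists2 i, (i < size W)%N & dec q i (~~ nth false W i).

Lemma avoid_mono q (r : PE R) W : fle r q -> avoid q W -> avoid r W.
Proof. by move=> rq [i iW /(dec_mono rq) ?]; exists i. Qed.

(** Deciding one bit at a position where [W] and [W'] differ excludes one of
them. *)
Lemma avoid_one_of_two q W W' : fle q p0 -> size W = size W' -> W != W' ->
  exists2 r, fle r q & avoid r W \/ avoid r W'.
Proof.
move=> qp sW nW.
have [i iW ni] : exists2 i, (i < size W)%N & nth false W i != nth false W' i.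
  apply: contrapT => nex; move/negP: nW; apply; apply/eqP.
  apply: (@eq_from_nth _ false) => // i iW; apply/eqP; apply: contraT => ni.
  by case: nex; exists i.
have [r [b [rq rb]]] := dec_total i qp; exists r => //.
case: (eqVneq b (nth false W i)) => bW; [right|left]; exists i => //; first by rewrite -sW.
  by move: rb ni; rewrite bW; do 2 case: nth.
by move: rb bW; case: b; case: nth.
Qed.

Definition live q (Ws : seq (seq bool)) (s : seq bool) : bool :=
  `[< exists r, [/\ fle r q, sval r `<=` cylinder s &
                    forall W, W \in Ws -> avoid r W] >].

(** The live words have density at least [2 ^ - k * (1 + 2 ^ - i)].  The second
factor leaves room for a loss at every stage [i] while the density stays above
[2 ^ - k] for ever. *)
Definition heavy k i q Ws := forall n,
  (2 ^ n * (2 ^ i).+1 <= 2 ^ (k + i) * \sum_(s <- words n) (live q Ws s : nat))%N.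

Lemma live_rcons q Ws s b : live q Ws (rcons s b) -> live q Ws s.
Proof.
move=> /asboolP[r [rq rs rW]]; apply/asboolP; exists r; split=> //.
by apply: subset_trans rs _; apply: cylinder_prefix; exact: prefix_rcons.
Qed.

Lemma exists_heavy q Ws i : (forall W, W \in Ws -> avoid q W) ->
  exists k, heavy k i q Ws.
Proof.
move=> qW; have [k Hk] := positive_levels (pe_pos q); exists k => n.
apply: (@leq_trans (2 ^ i * 2 ^ n.+1)).
  rewrite expnS [leqRHS]mulnC -mulnA mulnCA leq_mul2l mul2n -addnn -[(2 ^ i).+1]addn1.
  by rewrite leq_add2l expn_gt0 orbT.
rewrite addnC expnD -mulnA leq_mul2l; apply/orP; right; apply: (leq_trans (Hk n)).
rewrite leq_mul2l; apply/orP; right; apply: leq_sum => s _.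
case: asboolP => // ps; rewrite lt0b; apply/asboolP.
have bqs : borel (sval q `&` cylinder s).
  by apply: borel_setI (pe_borel q) (borel_closed (cylinder_clopen s).2).
have lq : fle (pe_cond bqs ps) q by exact: subIsetl.
exists (pe_cond bqs ps); split=> //; first exact: subIsetr.
by move=> W /qW; exact: avoid_mono.
Qed.

Lemma live_split q Ws l s (O r r' : seq bool) :
  fle q p0 -> size r = l -> size r' = l -> r != r' ->
  live q Ws s -> live q ((O ++ r) :: Ws) s || live q ((O ++ r') :: Ws) s.
Proof.
move=> qp rl r'l rr' /asboolP[c [cq cs cW]].
have [d dc dW] : exists2 d, fle d c & avoid d (O ++ r) \/ avoid d (O ++ r').
  apply: avoid_one_of_two; first exact: fle_trans cq qp.
    by rewrite !size_cat rl r'l.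
  by rewrite eqseq_cat// eqxx.
have dWs W : W \in Ws -> avoid d W by move/cW; exact: avoid_mono.
have gd W : avoid d W -> live q (W :: Ws) s.
  move=> dW'; apply/asboolP; exists d; split.
  - exact: fle_trans dc cq.
  - exact: subset_trans dc cs.
  - by move=> W'; rewrite inE => /orP[/eqP->//|]; exact: dWs.
by case: dW => /gd ->; rewrite ?orbT.
Qed.

(** * One stage of the fusion *)

Definition heavy_all (X : seq (node R)) i Ws :=
  forall t, t \in X -> heavy (nfrac t) i (ncond t) Ws.

(** For each [n] averaging over the words [r] of length [l] gives one which is
cheap for all nodes at length [n].  Being cheap at [n] implies being cheap below
[n], and there are finitely many [r], so one of them is cheap at all
lengths. *)
Lemma exists_next_word (X : seq (node R)) i Ws O :
  (forall t, t \in X -> fle (ncond t) p0) -> heavy_all X i Ws ->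
  exists2 W, prefix O W & heavy_all X i.+1 (W :: Ws).
Proof.
move=> Xp HX.
pose cnt n t Ws := (\sum_(s <- words n) (live (ncond t) Ws s : nat))%N.
(* With [2 ^ E] at least all the denominators [2 ^ (nfrac t + i.+1)] and
   [2 ^ size X >= size X], the loss at each node is at most
   [2 ^ - (nfrac t + i.+1)], the difference between the densities asked of a
   heavy node at stages [i] and [i.+1]. *)
pose E := (\sum_(t <- X) nfrac t + i.+1)%N.
pose l := (size X + E)%N.
pose ok n W := forall t, t \in X ->
  (2 ^ n * (2 ^ i.+1).+1 <= 2 ^ (nfrac t + i.+1) * cnt n t (W :: Ws))%N.
have step n : exists2 r, size r = l & ok n (O ++ r).
  pose loss t r := (\sum_(s <- words n)
    (live (ncond t) Ws s && ~~ live (ncond t) ((O ++ r) :: Ws) s : nat))%N.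
  have total : (\sum_(r <- words l) \sum_(t <- X) loss t r <= size X * 2 ^ n)%N.
    rewrite exchange_big /= -sum1_size big_distrl /= !big_seq; apply: leq_sum => t tX.
    rewrite mul1n -sum_words1; apply: (@leq_trans (cnt n t Ws)); last first.
      by apply: leq_sum => s _; exact: leq_b1.
    apply: sum_words_loss => s r r' rl r'l rr'.
    exact: live_split (Xp t tX) rl r'l rr'.
  have [|r] := exists_le_average _ total; first by rewrite size_words expn_gt0.
  rewrite size_words mem_words => /eqP rl le; exists r => // t tX.
  have le1 : (2 ^ (nfrac t + i.+1) * loss t r <= 2 ^ n)%N.
    have kE : (nfrac t + i.+1 <= E)%N.
      by rewrite leq_add2r (big_rem t)//= leq_addr.
    apply: (@leq_trans (2 ^ E * loss t r)); first by rewrite leq_mul2r leq_exp2l// kE orbT.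
    have X0 : (0 < 2 ^ size X)%N by rewrite expn_gt0.
    rewrite -(leq_pmul2l X0) mulnA -expnD.
    apply: (@leq_trans (2 ^ l * \sum_(t <- X) loss t r)).
      by rewrite leq_mul2l; apply/orP; right; rewrite [leqRHS](big_rem t)//= leq_addr.
    by apply: (leq_trans le); rewrite leq_mul2r; apply/orP; right; apply/ltnW/ltn_expl.
  have split : (cnt n t Ws <= cnt n t ((O ++ r) :: Ws) + loss t r)%N.
    rewrite /cnt /loss -big_split; apply: leq_sum => s _ /=.
    by case: (live _ Ws s) => //; case: live.
  have old : (2 ^ n * ((2 ^ i.+1).+1 + 1) <= 2 ^ (nfrac t + i.+1) * cnt n t Ws)%N.
    rewrite (addnS (nfrac t)) (expnS 2 (nfrac t + i)) -mulnA.
    apply: (@leq_trans (2 * (2 ^ n * (2 ^ i).+1))); last by rewrite leq_mul2l HX.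
    by rewrite mulnCA leq_mul2l; apply/orP; right; rewrite expnS addn1 mulnS.
  rewrite -(leq_add2r (2 ^ n * 1)) -mulnDr; apply: (leq_trans old).
  apply: (@leq_trans (2 ^ (nfrac t + i.+1) * (cnt n t ((O ++ r) :: Ws) + loss t r))).
    by rewrite leq_mul2l split orbT.
  by rewrite mulnDr leq_add2l muln1.
(* A word bad at some length is bad at all larger ones; if every [r] were bad,
   they would all be bad at the maximum of the lengths [f r]. *)
have okS n W : ok n.+1 W -> ok n W.
  move=> okn t tX; have := okn t tX => H.
  rewrite -(leq_pmul2l (isT : 0 < 2)%N) mulnA -expnS; apply: (leq_trans H).
  rewrite [leqRHS]mulnCA leq_mul2l; apply/orP; right.
  by apply: sum_words_shrink => s b; exact: live_rcons.
have okle m n W : (m <= n)%N -> ok n W -> ok m W.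
  by move/subnK <-; elim: (n - m)%N => // d IH; rewrite addSn => /okS.
apply: contrapT => none.
have /choice[f Hf] : forall r, exists n, size r = l -> ~ ok n (O ++ r).
  move=> r; apply: contrapT => /forallNP H; apply: none.
  exists (O ++ r); first exact: prefix_prefix.
  by move=> t tX n; have /not_implyP[_ /contrapT] := H n; apply.
have [r rl okr] := step (\max_(r <- words l) f r).
apply: (Hf r rl); apply: okle okr.
by apply: (@leq_bigmax_seq _ _ xpredT f) => //; rewrite mem_words rl.
Qed.

(** The history of [t'] records the intermediate condition [q], to which the
limit points of branches through [t'] will belong. *)
Definition child (t : node R) (s : seq bool) (t' : node R) := exists q,
  [/\ fle q (ncond t), sval q `<=` cylinder s,
      extends (nhist t) (sval q) (nhist t') & fle (ncond t') q].

Definition stage_inv i (X : seq (node R)) Ws := forall t, t \in X ->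
  [/\ fle (ncond t) p0, wf_hist (nhist t), sval (ncond t) `<=` region (nhist t) &
      heavy (nfrac t) i (ncond t) Ws].

Lemma exists_stage i X Ws O : stage_inv i X Ws -> exists WY : seq bool * seq (node R),
  [/\ prefix O WY.1, stage_inv i.+1 (X ++ WY.2) (WY.1 :: Ws),
      forall t, t \in WY.2 -> avoid (ncond t) WY.1 /\
        forall W, W \in Ws -> avoid (ncond t) W &
      forall t s, t \in X -> size s = i -> live (ncond t) (WY.1 :: Ws) s ->
        exists2 t', t' \in WY.2 & child t s t'].
Proof.
move=> inv.
have [|t /inv[]//|W OW HW] := @exists_next_word X i Ws O; first by move=> t /inv[].
have /choice[f Hf] : forall ts : node R * seq bool, exists t',
    ts.1 \in X -> live (ncond ts.1) (W :: Ws) ts.2 ->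
    [/\ child ts.1 ts.2 t', fle (ncond t') p0, wf_hist (nhist t'),
        sval (ncond t') `<=` region (nhist t') /\
        heavy (nfrac t') i.+1 (ncond t') (W :: Ws) &
        forall W', W' \in W :: Ws -> avoid (ncond t') W'].
  move=> [t s] /=; have [tX|] := boolP (t \in X); last by exists t.
  case: (boolP (live _ _ _)) => [/asboolP[q [qt qs qW]]|]; last by exists t.
  have [tp tw th _] := inv t tX.
  have [q' [h' [q'q wh' eh' q'h']]] := exists_extension tw (subset_trans qt th).
  have q'W W' : W' \in W :: Ws -> avoid q' W' by move/qW; exact: avoid_mono.
  have [k Hk] := exists_heavy i.+1 q'W.
  exists (Node q' h' k) => _ _; split=> //; first by exists q.
  exact: fle_trans q'q (fle_trans qt tp).
pose Y := [seq f (t, s) | t <- X, s <- [seq s <- words i | live (ncond t) (W :: Ws) s]].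
have HY t' : t' \in Y -> exists t s, [/\ t \in X, live (ncond t) (W :: Ws) s & t' = f (t, s)].
  case/allpairsPdep => t [s [tX + ->]]; rewrite mem_filter => /andP[gs _].
  by exists t, s.
exists (W, Y); split=> //=.
- move=> t; rewrite mem_cat => /orP[tX|/HY[t1 [s [tX gs ->]]]].
    by have [? ? ? _] := inv t tX; split=> //; exact: HW.
  by have [_ ? ? [? ?] _] := Hf (t1, s) tX gs.
- move=> t /HY[t1 [s [tX gs ->]]]; have [_ _ _ _ H] := Hf (t1, s) tX gs.
  by split=> [|W' W'W]; apply: H; rewrite inE ?eqxx ?W'W ?orbT.
- move=> t s tX si gs; exists (f (t, s)); last by have [] := Hf (t, s) tX gs.
  by apply/allpairsPdep; exists t, s; split=> //; rewrite mem_filter gs mem_words si eqxx.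
Qed.

(** * The limit of the fusion *)

Section Limit.
Variables (root : node R) (W : nat -> seq bool) (X Y : nat -> seq (node R)).
Hypothesis X0 : X 0%N = [:: root].
Hypothesis XS : forall i, X i.+1 = X i ++ Y i.
Let Ws i := rev (mkseq W i).
Hypothesis invX : forall i, stage_inv i (X i) (Ws i).
Hypothesis rootE : ncond root = p0 /\ nhist root = [::].
Hypothesis avoidY : forall i t j, t \in Y i -> (j <= i)%N -> avoid (ncond t) (W j).
Hypothesis childY : forall i t s, t \in X i -> size s = i ->
  live (ncond t) (Ws i.+1) s -> exists2 t', t' \in Y i & child t s t'.

(** Membership in the conditions of nodes born at arbitrarily late stages, and
not along one branch: this makes the set visibly Borel, and it suffices for
avoiding all [W i]. *)
Definition limit_set : set cantor_space :=
  \bigcap_i \bigcup_j \bigcup_k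
    (if (k < size (Y (i + j)))%N then sval (ncond (nth root (Y (i + j)) k)) else set0).

Lemma limit_borel : borel limit_set.
Proof.
apply: borel_bigcap => i; apply: borel_bigcup => j; apply: borel_bigcup => k.
by case: ifP => _; [exact: pe_borel|apply: borel_open; exact: open0].
Qed.

Lemma limitP x : limit_set x <->
  forall i, exists j t, [/\ (i <= j)%N, t \in Y j & sval (ncond t) x].
Proof.
split=> [Gx i|Gx i _].
  have [j _ [k _]] := Gx i I; case: ifP => // kY tx.
  by exists (i + j), (nth root (Y (i + j)) k); rewrite leq_addr mem_nth.
have [j [t [ij tY tx]]] := Gx i; exists (j - i) => //; exists (index t (Y j)) => //.
by rewrite subnKC// index_mem tY nth_index.
Qed.

Lemma Xmono i j t : (i <= j)%N -> t \in X i -> t \in X j.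
Proof.
move/subnK<-; elim: (j - i)%N => // d IH tX.
by rewrite addSn XS mem_cat IH.
Qed.

Lemma YX i t : t \in Y i -> t \in X i.+1.
Proof. by move=> tY; rewrite XS mem_cat tY orbT. Qed.

Lemma limit_sub : limit_set `<=` sval p0.
Proof.
move=> x /limitP /(_ 0%N) [j [t [_ /YX tX tx]]].
by have [tp _ _ _] := invX tX; exact: tp.
Qed.

Lemma limit_avoid q i : sval q `<=` limit_set -> exists2 r, fle r q & avoid r (W i).
Proof.
move=> qG.
have [j pj] := positive_piece (pe_pos q) (fun x qx => qG x qx i I).
have [k] := positive_piece pj (fun x (H : (_ `&` _) x) => H.2).
case: ifP => [kY|_]; last by rewrite setI0 => /(_ (idealE_set0 R)).
set t := nth root _ k => pt.
have pqt : ~ idealE R (sval q `&` sval (ncond t)).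
  by move=> E; apply: pt; apply: idealE_sub E => x [[]].
have bqt := borel_setI (pe_borel q) (pe_borel (ncond t)).
exists (pe_cond bqt pqt); first exact: subIsetl.
have : avoid (ncond t) (W i) by apply: (avoidY (mem_nth root kY)); exact: leq_addr.
by apply: avoid_mono; exact: subIsetr.
Qed.

(** At a late stage, the live words at [t] are more numerous than the words
whose cylinder meets [F], so one of them has a cylinder disjoint from [F]. *)
Lemma exists_child_off_null F i t : closed F -> haar R F = 0%E -> t \in X i ->
  exists n t' s, [/\ (i <= n)%N, t' \in Y n, size s = n, child t s t' &
    F `&` cylinder s = set0].
Proof.
move=> cF F0 tX.
have [n iin small] := haar_null_small (nfrac t) i cF F0.
have tXn := Xmono iin tX.
have [_ _ _ /(_ n)] := invX (Xmono (leqnSn n) tXn).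
rewrite addnC expnD -mulnA => large.
have {large} large : (2 ^ n <= 2 ^ nfrac t *
    \sum_(s <- words n) (live (ncond t) (Ws n.+1) s : nat))%N.
  rewrite -(leq_pmul2l (_ : 0 < 2 ^ n.+1)%N) ?expn_gt0//.
  by apply: leq_trans large; rewrite mulnC leq_mul2l ltnW ?orbT.
have [s [sn gs Fs]] : exists s, [/\ size s = n, live (ncond t) (Ws n.+1) s &
    F `&` cylinder s = set0].
  apply: contrapT => none.
  have := leq_trans small large; rewrite ltn_mul2l expn_gt0 /= ltnNge => /negP; apply.
  rewrite big_seq [leqRHS]big_seq; apply: leq_sum => s; rewrite mem_words => /eqP sn.
  case: (boolP (live _ _ _)) => // gs; rewrite lt0b; apply/asboolP.
  by apply/set0P/eqP => Fs; apply: none; exists s.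
have [t' t'Y ch] := childY tXn sn gs.
by exists n, t', s.
Qed.

(** Given closed null sets [C k], follow a branch of nodes whose [k]-th step
enters a cylinder disjoint from [C k].  The cylinders converge to a point [x]
outside all [C k], and completeness of the schemes puts [x] into every condition
of the branch. *)
Lemma limit_pos : ~ idealE R limit_set.
Proof.
move=> [C [HC GC]].
have /choice[f Hf] : forall kit : nat * (nat * node R), exists z : nat * node R,
    kit.2.2 \in X kit.2.1 -> z.2 \in X z.1 /\
    exists n s, [/\ (kit.2.1 <= n)%N, z.1 = n.+1, z.2 \in Y n, size s = n &
       child kit.2.2 s z.2 /\ C kit.1 `&` cylinder s = set0].
  move=> [k [i t]] /=; have [tX|] := boolP (t \in X i); last by exists (0%N, t).
  have [n [t' [s [iin t'Y sn ch Fs]]]] := exists_child_off_null (HC k).1 (HC k).2 tX.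
  by exists (n.+1, t') => _; split; [exact: YX|exists n, s].
pose z := fix z k := if k is k'.+1 then f (k', z k') else (0%N, root).
have zX k : (z k).2 \in X (z k).1.
  by elim: k => [|k IH]; [rewrite /= X0 mem_seq1|have [] := Hf (k, z k) IH].
have /choice[s Hs] : forall k, exists s, [/\ (z k).1 <= size s, (z k.+1).1 = (size s).+1,
    (z k.+1).2 \in Y (size s), child (z k).2 s (z k.+1).2 & C k `&` cylinder s = set0]%N.
  move=> k; have [_ [n [s [? ? ? sn [? ?]]]]] := Hf (k, z k) (zX k).
  by exists s; rewrite sn.
have /choice[q Hq] : forall k, exists q : PE R,
  [/\ fle q (ncond (z k).2), sval q `<=` cylinder (s k),
      extends (nhist (z k).2) (sval q) (nhist (z k.+1).2) & fle (ncond (z k.+1).2) q].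
  by move=> k; have [_ _ _ [q ?] _] := Hs k; exists q.
have ks k : (k <= size (s k))%N.
  have [+ _ _ _ _] := Hs k; apply: leq_trans.
  elim: k => // k IH; have [le -> _ _ _] := Hs k.
  by rewrite ltnS (leq_trans IH).
have /choice[y Hy] : forall k, exists x, sval (ncond (z k).2) x.
  move=> k; apply: contrapT => /forallNP no; apply: (pe_pos (ncond (z k).2)).
  by apply: idealE_sub (idealE_set0 R) => x /no.
have zdec k d : fle (ncond (z (k + d)).2) (ncond (z k).2).
  elim: d => [|d IH]; first by rewrite addn0; exact: fle_refl.
  rewrite addnS; have [H1 _ _ H2] := Hq (k + d).
  exact: fle_trans H2 (fle_trans H1 IH).
have ys k j : (k < j)%N -> cylinder (s k) (y j).
  move/subnKC <-; have [_ + _ H] := Hq k; apply; apply: H.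
  exact: zdec.
(* The word [s i.+1] has length more than [i] and is an initial segment of
   [y j] for every [j > i.+1], so the bit [i] is settled from [y i.+2] on. *)
pose x : cantor_space := fun i => y i.+2 i.
have xy k j : (k < j)%N -> agree (size (s k)) x (y j).
  move=> kj i ik; rewrite /x; case: (ltnP k i.+2) => ki.
    by rewrite (ys k i.+2)// (ys k j).
  have ii : (i < size (s i.+1))%N := ks i.+1.
  by rewrite (ys i.+1 i.+2)// (ys i.+1 j)// (ltn_trans _ kj).
have xs k : cylinder (s k) x.
  by move=> i ik; rewrite (xy k k.+1)//; exact: (ys k k.+1).
have xq k : sval (q k) x.
  have [r0 h0] := rootE.
  apply: (@extends_complete (fun k => nhist (z k).2) (fun k => sval (q k)) x h0).
    by move=> n; have [_ _ + _] := Hq n.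
  move=> n; exists (y n.+1); last first.
    by move=> i ni; apply: (xy n) => //; exact: leq_trans (ks n).
  have [_ _ + _] := invX (zX n); apply.
  by have [H1 _ _ H2] := Hq n; apply: H1; apply: H2.
have [|k _ Ckx] := GC x; last first.
  by have [_ _ _ _ Ck0] := Hs k; rewrite -[False]/(set0 x) -Ck0; split.
apply/limitP => k; have [_ _ zY _ _] := Hs k.
exists (size (s k)), (z k.+1).2; split=> //.
by have [H1 _ _ _] := Hq k.+1; apply: H1.
Qed.

End Limit.

(** Iterating the stages gives the limit condition; as [O] may enumerate all
words, the [W i] can be made dense. *)
Theorem exists_fusion (O : nat -> seq bool) : exists (W : nat -> seq bool) (p : PE R),
  [/\ fle p p0, forall i, prefix (O i) (W i) &
      forall q i, fle q p -> exists2 r, fle r q & avoid r (W i)].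
Proof.
have /choice[f Hf] : forall a : nat * (seq (node R) * seq (seq bool)),
    exists WY : seq bool * seq (node R), stage_inv a.1 a.2.1 a.2.2 ->
  [/\ prefix (O a.1) WY.1, stage_inv a.1.+1 (a.2.1 ++ WY.2) (WY.1 :: a.2.2),
      forall t, t \in WY.2 -> avoid (ncond t) WY.1 /\
        forall W, W \in a.2.2 -> avoid (ncond t) W &
      forall t s, t \in a.2.1 -> size s = a.1 -> live (ncond t) (WY.1 :: a.2.2) s ->
        exists2 t', t' \in WY.2 & child t s t'].
  move=> [i [X Ws]] /=; have [/(exists_stage (O i))[WY ?]|no] := pselect (stage_inv i X Ws).
    by exists WY.
  by exists ([::], [::]).
have [k Hk] : exists k, heavy k 0 p0 [::] by apply: exists_heavy.
pose root := Node p0 [::] k.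
(* The nodes and the words present at the start of stage [i], the latest word
   first. *)
pose st := fix st i := if i is j.+1 then
  ((st j).1 ++ (f (j, st j)).2, (f (j, st j)).1 :: (st j).2) else ([:: root], [::]).
pose W i := (f (i, st i)).1; pose Y i := (f (i, st i)).2.
have inv i : stage_inv i (st i).1 (st i).2.
  elim: i => [|i IH]; last by have [] := Hf (i, st i) IH.
  move=> t; rewrite inE => /eqP->; split=> //.
  - move=> i u; rewrite /track nth_nil; split; last by exists 0%N.
    by apply: borel_closed; exact: closedT.
  - by move=> x _ i _; rewrite /track nth_nil.
have WsE i : (st i).2 = rev (mkseq W i).
  by elim: i => //= i ->; rewrite mkseqS_rcons rev_rcons.
have invX i : stage_inv i (st i).1 (rev (mkseq W i)) by rewrite -WsE.
have avoidY i t j : t \in Y i -> (j <= i)%N -> avoid (ncond t) (W j).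
  move=> tY; have [_ _ /(_ t tY)[tW tWs] _] := Hf (i, st i) (inv i).
  rewrite leq_eqVlt => /orP[/eqP->//|ji]; apply: tWs.
  by rewrite WsE mem_rev; apply: map_f; rewrite mem_iota.
have childY i t s : t \in (st i).1 -> size s = i ->
    live (ncond t) (rev (mkseq W i.+1)) s -> exists2 t', t' \in Y i & child t s t'.
  rewrite -WsE; have [_ _ _] := Hf (i, st i) (inv i); exact.
have pos := @limit_pos root W (fun i => (st i).1) Y erefl (fun=> erefl) invX
  (conj erefl erefl) childY.
exists W, (pe_cond (limit_borel root Y) pos); split.
- exact: (limit_sub (fun=> erefl) invX).
- by move=> i; have [] := Hf (i, st i) (inv i).
- move=> q i qG; exact: (@limit_avoid root W Y avoidY q i qG).
Qed.

End Fusion.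

(** * Names for Cohen reals *)

Section Names.
Variable P : forcing.
Implicit Types (t x : name P) (p q r : P).

Lemma feq_sym s t p : feq s t p -> feq t s p.
Proof.
elim: s t p => I x IH c [J y d] p /= [st ts]; split=> k q qp qk.
  have [r [rq [i [rc e]]]] := ts k q qp qk.
  by exists r; split=> //; exists i; split=> //; exact: IH.
have [r [rq [j [rd e]]]] := st k q qp qk.
by exists r; split=> //; exists j; split=> //; exact: IH.
Qed.

Lemma fmem_mono s t p q : fle q p -> fmem s t p -> fmem s t q.
Proof. by case: t => J y d qp H r rq; apply: H; exact: fle_trans rq qp. Qed.

(** The name [z] is forced equal to the canonical name of some [s] in [D] and to
be a subset of [x], so that all the pairs in [s] are forced into [x]. *)
Lemma fcohen_meets x p (D : set (seq bool)) : fcohen x p -> dense_seqs D ->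
  forall q, fle q p -> exists r (s : seq bool), [/\ fle r q, D s &
    forall i, (i < size s)%N -> fmem (check P (ventry i (nth false s i))) x r].
Proof.
move=> [_ cohen] dD q qp.
have [r [rq [z [zD zx]]]] := cohen (exist _ D dD) q qp.
have [r' [r'r [[[s Ds] c] [_ zs]]]] := zD r (fle_refl r).
exists r', s; split=> //; first exact: fle_trans r'r rq.
move=> i si; apply: (zx (check P (ventry i (nth false s i))) r' r'r).
move: zs; case: z {zD zx} => J y d zs /= q' q'r'.
have [_ zs2] := zs.
have [r'' [r''q [j [r''d e]]]] := zs2 (Ordinal si, q') q' q'r' (fle_refl q').
by exists r''; split=> //; exists j; split=> //; exact: (feq_sym e).
Qed.

Lemma freal_decides x p : freal x p -> forall q n, fle q p ->
  exists r b, fle r q /\ fmem (check P (ventry n b)) x r.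
Proof.
move=> [_ [tot _]] q n qp; have [r [rq [b rb]]] := tot n q qp.
by exists r, b.
Qed.

Lemma freal_consistent x p : freal x p -> forall q n b, fle q p ->
  fmem (check P (ventry n b)) x q -> fmem (check P (ventry n (~~ b))) x q -> False.
Proof.
move=> [_ [_ con]] q n b qp; have := con n q qp.
by case: b => H1 H2 H3; apply: H1; split.
Qed.

End Names.

Theorem theorem7p1 (R : realType) : adds_no_cohen_real (PE R).
Proof.
move=> p0 p _ adds; have [p1 [_ [x cohen]]] := adds p (fle_refl p).
have real : freal x p1 by case: cohen.
pose dec q n b := fmem (check (PE R) (ventry n b)) x q.
pose O i : seq bool := odflt [::] (unpickle i).
have [W [p' [p'p1 OW avoids]]] := exists_fusion (dec := dec)
  (fun q r n b => @fmem_mono (PE R) _ x q r) (freal_decides real) O.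
have dW : dense_seqs (range W).
  by move=> s; exists (W (pickle s)); split; [exists (pickle s)|
    have := OW (pickle s); rewrite /O pickleK].
have [q [_ [qp' [i _ <-] qW]]] := fcohen_meets cohen dW p'p1.
have [r rq [n nW rn]] := avoids q i qp'.
apply: (freal_consistent real (q := r) (n := n) (b := nth false (W i) n)) => //.
  exact: fle_trans rq (fle_trans qp' p'p1).
exact: fmem_mono rq (qW n nW).
Qed.
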